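(* Let $\Psi$ be an index function such that $$J(x^\dagger)-J(x_\alpha)\le \Psi(\alpha)\quad\text{for all }\alpha>0 .$$ Then $$B_{\xi_\alpha^\delta}(x_\alpha^\delta;x^\dagger)\le \frac{\delta^2}{2\alpha}+\Psi(\alpha)\quad\text{for all }\alpha>0 .$$
   Context: Setting. $X$ is an infinite-dimensional Banach space, $H$ an infinite-dimensional Hilbert space with norm $\|\cdot\|$, and $A:X\to H$ a bounded linear operator with non-closed range; $A^*:H\to X^*$ is its adjoint. $J:X\to[0,\infty]$ is a proper convex functional, lower semi-continuous with respect to weak (or weak$^*$) sequential convergence, such that for every $c\ge0$ the sublevel set $\{x\in X: J(x)\le c\}$ is weakly (or weak$^*$) sequentially compact. $y\in \mathrm{range}(A)$, and $Ax=y$ has at least one solution with finite penalty value. $x^\dagger\in X$ denotes a $J$-minimizing solution: $Ax^\dagger=y$ and $J(x^\dagger)=\min\{J(x): x\in X, Ax=y\}<\infty$. The noisy data $y^\delta\in H$ satisfy $\|y^\delta-y\|\le\delta$, with $\delta\ge0$. Tikhonov functional: for $\alpha>0$ and $v\in H$, $T_\alpha(x;v):=\frac12\|Ax-v\|^2+\alpha J(x)$, $x\in X$. For each $\alpha>0$, $x_\alpha$ is an (arbitrarily selected) minimizer of $T_\alpha(\cdot;y)$ over $X$ and $x_\alpha^\delta$ is an (arbitrarily selected) minimizer of $T_\alpha(\cdot;y^\delta)$ over $X$. Bregman distance: for $z\in X$ and $\zeta\in\partial J(z)\subset X^*$ (convex subdifferential), $B_\zeta(z;x):=J(x)-J(z)-\langle\zeta,x-z\rangle$,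 $x\in X$. Convention: $\xi_\alpha^\delta\in\partial J(x_\alpha^\delta)$ is the subgradient satisfying the optimality condition $A^*(Ax_\alpha^\delta-y^\delta)+\alpha\,\xi_\alpha^\delta=0$. An index function is a function $\varphi:(0,\infty)\to(0,\infty)$ that is continuous, strictly increasing and satisfies $\lim_{t\to+0}\varphi(t)=0$. *)

(* Defs.v *)
From HB Require Import structures.
From mathcomp Require Import all_boot all_order all_algebra.
From mathcomp Require Import sesquilinear.
From mathcomp Require Import all_classical all_reals all_analysis.
From mathcomp Require Import ring.

Set Implicit Arguments.
Unset Strict Implicit.
Unset Printing Implicit Defensive.

Import Order.TTheory GRing.Theory Num.Theory.
Import numFieldNormedType.Exports.

Local Open Scope classical_set_scope.
Local Open Scope ring_scope.

Section BoundedLinearMaps.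
Context {R : realType} {X Y : normedModType R}.

Definition is_bounded_linear : {pred X -> Y} :=
  fun f => `[< linear f /\ bounded_near f (nbhs (0 : X)) >].

Record bounded_linear : Type := BoundedLinear {
  bounded_linear_fun :> X -> Y;
  _ : bounded_linear_fun \in is_bounded_linear }.

HB.instance Definition _ := [isSub for bounded_linear_fun].
HB.instance Definition _ := [Choice of bounded_linear by <:].

Lemma bounded_linearP (f : X -> Y) :
  f \in is_bounded_linear <->
  linear f /\ exists M, forall x, `|f x| <= M * `|x|.
Proof.
rewrite unfold_in /is_bounded_linear; split=> [/asboolP[lf bf]|[lf [M bf]]].
- split=> //.
  pose g : {linear X -> Y} := HB.pack f (GRing.isLinear.Build _ _ _ _ _ lf).
  have /(@linear_boundedP _ _ _ g) h : bounded_near g (nbhs (0 : X)) by [].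
  near (+oo : set_system R) => r; exists r.
  by near: r; exact: h.
- apply/asboolP; split=> //.
  pose g : {linear X -> Y} := HB.pack f (GRing.isLinear.Build _ _ _ _ _ lf).
  apply/(@bounded_funP _ _ _ g) => r; exists (`|M| * r) => x xr.
  rewrite (le_trans (bf x))// (@le_trans _ _ (`|M| * `|x|))//.
    by rewrite ler_wpM2r// ler_norm.
  by rewrite ler_wpM2l.
Unshelve. all: by end_near. Qed.

Fact is_bounded_linear_submod : submod_closed is_bounded_linear.
Proof.
split.
  apply/bounded_linearP; split.
    by move=> a u v; rewrite /= scaler0 addr0.
  by exists 0 => x; rewrite mul0r normr0.
move=> a f g /bounded_linearP[lf [M fM]] /bounded_linearP[lg [N gN]].
apply/bounded_linearP; split.
  move=> b u v.
  change (a *: f (b *: u + v) + g (b *: u + v) =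
    b *: (a *: f u + g u) + (a *: f v + g v)).
  by rewrite lf lg !scalerDr !scalerA mulrC addrACA.
exists (`|a| * M + N) => x.
change (`|a *: f x + g x| <= (`|a| * M + N) * `|x|).
rewrite (le_trans (ler_normD _ _))// mulrDl lerD//.
by rewrite normrZ -mulrA ler_wpM2l.
Qed.

HB.instance Definition _ :=
  GRing.isSubmodClosed.Build R (X -> Y) is_bounded_linear
    is_bounded_linear_submod.
HB.instance Definition _ := [SubChoice_isSubLmodule of bounded_linear by <:].

Lemma bounded_linear_linear (f : bounded_linear) : linear f.
Proof. by case: f => f /= /bounded_linearP[]. Qed.

HB.instance Definition _ (f : bounded_linear) :=
  GRing.isLinear.Build R X Y *:%R f (bounded_linear_linear f).

Definition opnorm (f : bounded_linear) : R :=
  sup [set `|f x| | x in [set x | `|x| <= 1]].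

End BoundedLinearMaps.

Arguments bounded_linear {R} X Y.

Definition dual (R : realType) (X : normedModType R) : Type :=
  bounded_linear X R^o.

HB.instance Definition _ (R : realType) (X : normedModType R) :=
  GRing.Lmodule.on (dual X).

Definition pairing (R : realType) (X : normedModType R) (zeta : dual X)
  (x : X) : R := bounded_linear_fun zeta x.

HB.mixin Record isHilbert (R : realType) H of CompleteNormedModule R H := {
  inner : {dot H for (@idfun R)};
  inner_norm : forall u : H, inner u u = `|u| ^+ 2
}.

#[short(type="hilbertType")]
HB.structure Definition Hilbert (R : realType) :=
  {H of CompleteNormedModule R H & isHilbert R H}.

Definition finite_dimensional (R : realType) (V : lmodType R) : Prop :=
  exists s : seq V, forall v : V,
    exists c : nat -> R, v = \sum_(i < size s) c i *: s`_i.

Section Adjoint.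
Context {R : realType} {X : normedModType R} {H : hilbertType R}.

Lemma inner_sym (u v : H) : inner u v = inner v u.
Proof. by rewrite (@hermitian_subproof _ _ _ _ (@inner R H)) expr0 mul1r. Qed.

Lemma inner_lin (u : H) : linear (inner u : H -> R^o).
Proof. by move=> a v w; rewrite linearD linearZ. Qed.

Lemma inner_bound (u v : H) : `|inner u v| <= `|u| * `|v|.
Proof.
have [->|v0] := eqVneq v 0.
  by rewrite (linear0r (@inner R H)) !normr0 mulr0.
have n0 : 0 < `|v| ^+ 2 by rewrite exprn_gt0// normr_gt0.
rewrite -ler_sqr ?nnegrE ?mulr_ge0// real_normK ?num_real// exprMn.
set n := `|v| ^+ 2 in n0 *; set p := inner u v.
have lin a b (w : H) : inner w (a *: u + b *: v) = a * inner w u + b * inner w v.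
  by rewrite inner_lin -[b *: v]addr0 inner_lin (linear0r (@inner R H)) addr0.
set w := n *: u + (- p) *: v.
have : 0 <= inner w w by rewrite inner_norm exprn_ge0.
rewrite {2}/w lin (inner_sym w u) (inner_sym w v) /w !lin (inner_sym v u).
rewrite -/p !inner_norm -/n.
have -> : n * (n * `|u| ^+ 2 + - p * p) + - p * (n * p + - p * n) =
  n * (`|u| ^+ 2 * n - p ^+ 2) by ring.
by rewrite pmulr_rge0// subr_ge0.
Qed.

Fact adjoint_subproof (A : bounded_linear X H) (h : H) :
  ((fun x => inner h (A x)) : X -> R^o) \in is_bounded_linear.
Proof.
have /bounded_linearP[lA [M AM]] : (A : X -> H) \in is_bounded_linear.
  by case: A.
apply/bounded_linearP; split; first by move=> a u v; rewrite lA inner_lin.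
exists (`|h| * M) => x; rewrite (le_trans (inner_bound _ _))// -mulrA.
by rewrite ler_wpM2l.
Qed.

Definition adjoint (A : bounded_linear X H) (h : H) : dual X :=
  BoundedLinear (adjoint_subproof A h).

End Adjoint.

Section WeakConvergence.
Context {R : realType}.

Definition weakly_cvg (X : normedModType R) (u : nat -> X) (x : X) : Prop :=
  forall f : dual X, pairing f (u n) @[n --> \oo] --> pairing f x.

Definition weak_star_cvg (Z : normedModType R) (f : nat -> dual Z)
    (g : dual Z) : Prop :=
  forall z : Z, pairing (f n) z @[n --> \oo] --> pairing g z.

(* [WeakStar] presupposes a predual: a Banach space [Z] and an isometric
   isomorphism [iota] identifying [X] with the dual of [Z]. *)
Variant weak_mode (X : normedModType R) : Type :=
| Weak
| WeakStar (Z : completeNormedModType R) (iota : {linear X -> dual Z})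
    of bijective iota & (forall x, opnorm (iota x) = `|x|).

Definition mode_cvg (X : normedModType R) (m : weak_mode X)
    (u : nat -> X) (x : X) : Prop :=
  match m with
  | Weak => weakly_cvg u x
  | WeakStar _ iota _ _ => weak_star_cvg (iota \o u) (iota x)
  end.

Definition seq_lower_semicontinuous (X : normedModType R) (m : weak_mode X)
    (J : X -> \bar R) : Prop :=
  forall (u : nat -> X) (x : X), mode_cvg m u x ->
    (J x <= limn_einf (J \o u))%E.

Definition seq_compact (X : normedModType R) (m : weak_mode X)
    (S : set X) : Prop :=
  forall u : nat -> X, (forall n, S (u n)) ->
    exists2 k : nat -> nat, increasing_seq k &
      exists2 x, S x & mode_cvg m (u \o k) x.

End WeakConvergence.

Section ConvexPenalty.
Context {R : realType} {X : normedModType R}.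
Local Open Scope ereal_scope.

Definition proper_functional (J : X -> \bar R) : Prop :=
  (forall x, J x != -oo) /\ exists x, J x < +oo.

(* The endpoints t = 0, 1 are harmless since [0 * +oo = 0] in [\bar R]. *)
Definition econvex (J : X -> \bar R) : Prop :=
  forall (t : R) (x z : X), (0 <= t <= 1)%R ->
    J (t *: x + (1 - t) *: z)%R <= t%:E * J x + (1 - t)%:E * J z.

(* For proper [J], membership forces [J z < +oo]. *)
Definition subdifferential (J : X -> \bar R) (z : X) : set (dual X) :=
  [set zeta | forall x, J z + (pairing zeta (x - z)%R)%:E <= J x].

Definition bregman (J : X -> \bar R) (zeta : dual X) (z x : X) : \bar R :=
  J x - J z - (pairing zeta (x - z)%R)%:E.

End ConvexPenalty.

Section Tikhonov.
Context {R : realType} {X : normedModType R} {H : hilbertType R}.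
Variables (A : bounded_linear X H) (J : X -> \bar R).
Local Open Scope ereal_scope.

Definition tikhonov (alpha : R) (v : H) (x : X) : \bar R :=
  (2^-1 * `|A x - v| ^+ 2)%R%:E + alpha%:E * J x.

Definition tikhonov_minimizer (alpha : R) (v : H) (x : X) : Prop :=
  forall x', tikhonov alpha v x <= tikhonov alpha v x'.

Definition J_minimizing_solution (y : H) (x : X) : Prop :=
  [/\ A x = y, (forall x', A x' = y -> J x <= J x') & J x < +oo].

End Tikhonov.

(* An index function lives on (0, oo); the values of [phi] on (-oo, 0] are
   irrelevant. *)
Definition index_function (R : realType) (phi : R -> R) : Prop :=
  [/\ (forall t, 0 < t -> 0 < phi t),
      {within `]0, +oo[, continuous phi},
      {in `]0, +oo[ &, {homo phi : s t / s < t}} &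
      phi t @[t --> 0^'+] --> 0].

(* Main.v *)
(* Write w = A xdelta - ydelta. The optimality condition turns the pairing in
   the Bregman distance into -<w, A (xdag - xdelta)> / alpha, and comparing
   x_alpha with xdelta in T_alpha(.; y) bounds J(x_alpha) - J(xdelta) by
   |A xdelta - y|^2 / (2 alpha). Expanding |A xdelta - y|^2 around w, the mixed
   terms cancel and what remains beyond J(xdag) - J(x_alpha) is
   (|ydelta - y|^2 - |w|^2) / (2 alpha). *)
Require Import Defs.
From HB Require Import structures.
From mathcomp Require Import all_boot all_order all_algebra.
From mathcomp Require Import all_classical all_reals all_analysis.
From mathcomp Require Import ring lra.

Import Order.TTheory GRing.Theory Num.Theory.
Import numFieldNormedType.Exports.

Local Open Scope classical_set_scope.
Local Open Scope ring_scope.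

Lemma hilbert_normD_sqr (R : realType) (H : hilbertType R) (u v : H) :
  `|u + v| ^+ 2 = `|u| ^+ 2 + 2 * inner u v + `|v| ^+ 2.
Proof.
rewrite -!inner_norm linearD/= !(inner_sym (u + v)) !linearD/=.
by rewrite (inner_sym v u); ring.
Qed.

(** An infinite [J x] would make the Tikhonov value at [x] infinite because [alpha > 0], whereas the
    competitor [z] has a finite value. *)
Lemma tikhonov_minimizer_fin_num (R : realType) (X : normedModType R)
    (H : hilbertType R) (A : bounded_linear X H) (J : X -> \bar R)
    (alpha : R) (v : H) (x z : X) :
  (forall x, 0 <= J x)%E -> 0 < alpha -> (J z < +oo)%E ->
  tikhonov_minimizer A J alpha v x -> J x \is a fin_num.
Proof.
move=> J_ge0 alpha0 Jz /(_ z); rewrite /tikhonov ge0_fin_numE//.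
have /fineK <- : J z \is a fin_num by rewrite ge0_fin_numE.
case: (J x) (J_ge0 x) => [r _ _|_|//]; first exact: ltry.
by rewrite gt0_muley ?lte_fin// addey// -EFinM -EFinD leye_eq.
Qed.

(** Evaluate the optimality condition at [z]; [adjoint A h] at [z] is [inner h (A z)] by
    computation. *)
Lemma pairing_optimality (R : realType) (X : normedModType R)
    (H : hilbertType R) (A : bounded_linear X H) (alpha : R) (h : H)
    (zeta : dual X) (z : X) :
  adjoint A h + alpha *: zeta = 0 -> alpha * pairing zeta z = - inner h (A z).
Proof.
move=> /(congr1 (fun f : dual X => bounded_linear_fun f z)) opt.
by apply/eqP; rewrite -addr_eq0 addrC; apply/eqP; exact: opt.
Qed.

Theorem theorem1 (R : realType)
  (X : completeNormedModType R) (X_inf : ~ finite_dimensional X)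
  (H : hilbertType R) (H_inf : ~ finite_dimensional H)
  (A : bounded_linear X H) (A_range : ~ closed (range A))
  (J : X -> \bar R) (J_ge0 : forall x, (0 <= J x)%E)
  (J_proper : proper_functional J) (J_convex : econvex J)
  (m : weak_mode X)
  (J_lsc : seq_lower_semicontinuous m J)
  (J_compact : forall c : R, 0 <= c ->
     seq_compact m [set x | (J x <= c%:E)%E])
  (y : H) (y_range : range A y)
  (y_finite : exists2 x, A x = y & (J x < +oo)%E)
  (xdag : X) (xdag_min : J_minimizing_solution A J y xdag)
  (delta : R) (delta_ge0 : 0 <= delta)
  (ydelta : H) (noise : `|ydelta - y| <= delta)
  (x_ : R -> X)
  (x_min : forall alpha, 0 < alpha -> tikhonov_minimizer A J alpha y (x_ alpha))
  (xdelta : R -> X)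
  (xdelta_min : forall alpha, 0 < alpha ->
     tikhonov_minimizer A J alpha ydelta (xdelta alpha))
  (xi : R -> dual X)
  (xi_subgradient : forall alpha, 0 < alpha ->
     subdifferential J (xdelta alpha) (xi alpha))
  (xi_optimality : forall alpha, 0 < alpha ->
     adjoint A (A (xdelta alpha) - ydelta) + alpha *: xi alpha = 0)
  (Psi : R -> R) (Psi_index : index_function Psi)
  (Psi_bound : forall alpha, 0 < alpha ->
     (J xdag - J (x_ alpha) <= (Psi alpha)%:E)%E) :
  forall alpha, 0 < alpha ->
    (bregman J (xi alpha) (xdelta alpha) xdag <=
       (delta ^+ 2 / (2 * alpha) + Psi alpha)%:E)%E.
Proof.
move=> alpha alpha0.
have [Axdag _ Jxdag] := xdag_min.
have Jdag : J xdag \is a fin_num by rewrite ge0_fin_numE.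
have Ja := tikhonov_minimizer_fin_num _ _ _ _ _ _ _ _ _
  J_ge0 alpha0 Jxdag (x_min alpha alpha0).
have Jd := tikhonov_minimizer_fin_num _ _ _ _ _ _ _ _ _
  J_ge0 alpha0 Jxdag (xdelta_min alpha alpha0).
have := x_min alpha alpha0 (xdelta alpha).
have := Psi_bound alpha alpha0.
(* The three penalty values are finite, so everything passes to real inequalities. *)
rewrite /bregman /tikhonov -(fineK Jdag) -(fineK Ja) -(fineK Jd).
rewrite -!EFinM -!EFinB -!EFinD !lee_fin => src cmp.
have := pairing_optimality _ _ _ _ _ _ _ (xdag - xdelta alpha)
  (xi_optimality alpha alpha0).
set w := A (xdelta alpha) - ydelta; set p := pairing _ _.
(* Since [A xdag = y], this one vector enters, up to sign, both the pairing and the misfit in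
   [cmp]. *)
have Ey : A (xdelta alpha) - y = w + (ydelta - y) by rewrite /w addrA subrK.
have -> : A (xdag - xdelta alpha) = - (w + (ydelta - y)).
  by rewrite linearB/= Axdag -Ey opprB.
rewrite linearN/= opprK linearD/= inner_norm => opt.
move: cmp; rewrite Ey (hilbert_normD_sqr _ _ w) => cmp.
have noise2 : `|ydelta - y| ^+ 2 <= delta ^+ 2 by rewrite lerXn2r ?nnegrE.
have a2 : 0 <= `|A (x_ alpha) - y| ^+ 2 by rewrite exprn_ge0.
have w2 : 0 <= `|w| ^+ 2 by rewrite exprn_ge0.
have src' : alpha * (fine (J xdag) - fine (J (x_ alpha))) <= alpha * Psi alpha.
  by rewrite ler_pM2l.
(* Scaling by [alpha] clears the quotient and leaves a goal linear in products with [alpha], inner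
   products and squared norms: add [src'], [cmp] and half of [noise2], substitute [opt], and drop
   half of [a2] and [w2] by sign. *)
rewrite -(ler_pM2l alpha0) !mulrDr.
have -> : alpha * (delta ^+ 2 / (2 * alpha)) = delta ^+ 2 / 2.
  by field; rewrite gt_eqF.
lra.
Qed.
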